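(* Let $G$ be an infinite ample Hausdorff groupoid, let $K$ be a field, and let $c:G\to H$ be a continuous cocycle into a discrete group $H$ with identity $e$ such that $c^{-1}(e)$ is strongly effective. Then $A_K(G)$, with the $H$-grading induced by $c$, is graded just infinite if and only if $|G|_W|<\infty$ for every proper, closed and invariant subset $W$ of $G^{(0)}$.
   Context: An ample Hausdorff groupoid is a locally compact Hausdorff étale topological groupoid $G$ (range map $r$, source map $s$, unit space $G^{(0)}$) having a basis of compact open bisections, where a bisection is a set on which $r$ and $s$ are injective. The Steinberg algebra is $A_K(G)=\mathrm{span}_K\{1_U: U\subseteq G\text{ a compact open bisection}\}$ with convolution product, determined by $1_U*1_V=1_{UV}$. A continuous cocycle (groupoid homomorphism) $c:G\to H$ induces the $H$-grading with components $A_K(G)_h=\mathrm{span}_K\{1_U: U\subseteq c^{-1}(h)\text{ a compact open bisection}\}$. A set $W\subseteq G^{(0)}$ is invariant if $r(s^{-1}(W))=W$, and then $G|_W:=s^{-1}(W)\cap r^{-1}(W)$. A groupoid $G$ is effective if the interior of $\mathrm{Iso}(G)=\{g\in G:r(g)=s(g)\}$ equals $G^{(0)}$; it is strongly effective if $G|_C$ is effective for every closed invariant $C\subseteq G^{(0)}$. (For $c^{-1}(e)$, which is an ample groupoid with unit space $G^{(0)}$, invariance is with respect to the groupoid $c^{-1}(e)$.) An ideal $I$ of an $H$-graded algebra $A=\bigoplus_h A_h$ is graded if $I=\bigoplus_h(A_h\cap I)$. A graded $K$-algebra $A$ is graded just infinite if $\dim_K A=\infty$ and $\dim_K A/J<\infty$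 for every nonzero graded ideal $J\subseteq A$. *)

(* Defs.v *)
From HB Require Import structures.
From mathcomp Require Import all_boot all_order all_algebra.
From mathcomp Require Import all_classical topology numfun.

Set Implicit Arguments.
Unset Strict Implicit.
Unset Printing Implicit Defensive.

Import GRing.Theory.

Local Open Scope classical_set_scope.
Local Open Scope ring_scope.

(** * Graded algebras

  Algebras here need not be unital, so an algebra is given by a subspace [A] of
  a [K]-vector space [V] and a product [mul] on [V]; only the values of [mul] on
  [A] are relevant. A grading is a family [Ah : H -> set V] of subspaces. *)

Section GradedAlgebra.
Context {K : fieldType} {V : lmodType K}.
Implicit Types (X A I J : set V) (mul : V -> V -> V).

Definition lin_span X : set V :=
  [set v | exists n (k : 'I_n -> K) (u : 'I_n -> V),
    (forall i, X (u i)) /\ v = \sum_(i < n) k i *: u i].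

Definition finite_dim A : Prop :=
  exists2 s : seq V, [set` s] `<=` A & A `<=` lin_span [set` s].

(* The quotient [A / J] is finite dimensional: it is spanned by the classes of
   finitely many elements of [A]. *)
Definition finite_dim_quotient A J : Prop :=
  exists2 s : seq V, [set` s] `<=` A &
    A `<=` [set x + y | x in lin_span [set` s] & y in J].

Definition is_ideal mul A I : Prop :=
  [/\ I `<=` A, I 0,
      forall (k : K) x y, I x -> I y -> I (k *: x + y)
    & forall a x, A a -> I x -> I (mul a x) /\ I (mul x a)].

Definition finite_section {H : choiceType} (B : H -> set V) (b : H -> V) :=
  (forall h, B h (b h)) /\ finite_set [set h | b h != 0].

(* [I] is the internal direct sum of the subspaces [B h]. *)
Definition is_direct_sum {H : choiceType} I (B : H -> set V) : Prop :=
  I = [set x | exists2 b, finite_section B b & x = \sum_(h \in [set: H]) b h]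
  /\ forall b, finite_section B b ->
       \sum_(h \in [set: H]) b h = 0 -> forall h, b h = 0.

Definition is_graded_ideal {H : choiceType} mul A (Ah : H -> set V) I : Prop :=
  is_ideal mul A I /\ is_direct_sum I (fun h => Ah h `&` I).

Definition graded_just_infinite {H : choiceType} mul A (Ah : H -> set V) :=
  ~ finite_dim A /\
  forall J, is_graded_ideal mul A Ah J -> J <> [set 0] ->
    finite_dim_quotient A J.

End GradedAlgebra.

(** * Topological groupoids

  A groupoid is identified with its set of arrows, its units being the arrows
  [rng g]. The product [gmul] is total, but it is constrained only on composable
  pairs, i.e., those with [src g = rng h]. *)

Record topGroupoid := TopGroupoid {
  arrow :> topologicalType;
  rng : arrow -> arrow;
  src : arrow -> arrow;
  ginv : arrow -> arrow;
  gmul : arrow -> arrow -> arrow;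
  rng_rng : forall g, rng (rng g) = rng g;
  src_rng : forall g, src (rng g) = rng g;
  rng_src : forall g, rng (src g) = src g;
  src_src : forall g, src (src g) = src g;
  rng_gmul : forall g h, src g = rng h -> rng (gmul g h) = rng g;
  src_gmul : forall g h, src g = rng h -> src (gmul g h) = src h;
  gmulA : forall g h k, src g = rng h -> src h = rng k ->
    gmul g (gmul h k) = gmul (gmul g h) k;
  gmul_rng : forall g, gmul (rng g) g = g;
  gmul_src : forall g, gmul g (src g) = g;
  rng_ginv : forall g, rng (ginv g) = src g;
  src_ginv : forall g, src (ginv g) = rng g;
  gmulV : forall g, gmul g (ginv g) = rng g;
  gmulVg : forall g, gmul (ginv g) g = src g;
  ginv_continuous : continuous ginv;
  gmul_continuous :
    {within [set p : arrow * arrow | src p.1 = rng p.2],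
      continuous (fun p => gmul p.1 p.2)}
}.

Section Groupoid.
Context {G : topGroupoid}.
Implicit Types (S U V W : set G).

Definition unit_space : set G := range (@rng G).

(* [f] is a local homeomorphism from [G] to its subspace [Y]. *)
Definition local_homeomorphism (f : G -> G) (Y : set G) : Prop :=
  range f `<=` Y /\
  forall x, exists U, [/\ open_nbhs x U, set_inj U f,
    {within U, continuous f}
    & forall V, V `<=` U -> open V -> open (f @` V : set (subspace Y))].

Definition etale : Prop := local_homeomorphism (@rng G) unit_space.

Definition bisection U : Prop := set_inj U (@rng G) /\ set_inj U (@src G).

Definition compact_open_bisection U : Prop :=
  [/\ compact U, open U & bisection U].

Definition ample_hausdorff : Prop :=
  [/\ locally_compact [set: G], hausdorff_space G, etale
    & basis compact_open_bisection].

(** The notions below are relative to a subgroupoid of [G], given by its set of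
  arrows [S] and carrying the subspace topology; [S := [set: G]] is [G] itself.
  Recall that, within [subspace S], the points outside [S] are isolated, so that
  for subsets of [S] the topology of [subspace S] is the relative one. *)

Definition units S : set G := S `&` unit_space.

Definition isotropy S : set G := S `&` [set g | rng g = src g].

Definition effective S : Prop :=
  (isotropy S : set (subspace S))° = units S.

Definition invariant_in S W : Prop := (@rng G) @` (S `&` (@src G) @^-1` W) = W.

Definition restriction S W : set G :=
  S `&` ((@src G) @^-1` W `&` (@rng G) @^-1` W).

Definition closed_in_units S W : Prop :=
  W `<=` units S /\ closed (W : set (subspace (units S))).

Definition strongly_effective S : Prop :=
  forall C, closed_in_units S C -> invariant_in S C -> effective (restriction S C).

Definition cocycle {H : groupType} (c : G -> H) : Prop :=
  forall g h : G, src g = rng h -> c (gmul g h) = (c g * c h)%g.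

End Groupoid.

(** * Steinberg algebras *)

Section Steinberg.
Context (G : topGroupoid) (K : fieldType).

(* For [f] and [g] in the Steinberg algebra the sum has finite support; [\sum]
   over a family with infinite support is 0. *)
Definition convolution (f g : G -> K^o) : G -> K^o := fun x =>
  \sum_(p \in [set p : G * G | src p.1 = rng p.2 /\ gmul p.1 p.2 = x])
    (f p.1 * g p.2 : K).

Definition steinberg : set (G -> K^o) :=
  lin_span [set (\1_U : G -> K^o) | U in @compact_open_bisection G].

Definition steinberg_component (H : groupType) (c : G -> H) (h : H) :
    set (G -> K^o) :=
  lin_span [set (\1_U : G -> K^o) | U in
    [set U | @compact_open_bisection G U /\ U `<=` c @^-1` [set h]]].

Lemma convolution_indic (U V : set G) : bisection U -> bisection V ->
  convolution \1_U \1_V =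
  \1_[set gmul p.1 p.2 | p in [set p | [/\ U p.1, V p.2 & src p.1 = rng p.2]]].
Proof.
move=> [Ur _] [_ Vs]; apply/funext => x; rewrite /convolution indicE.
have [xUV|xUV] := boolP (x \in _); last first.
  rewrite fsbig1// => -[g h] /= [gh ghx]; rewrite !indicE -natrM mulnb.
  have [/andP[gU hV]|//] := boolP (_ && _).
  case/negP: xUV; apply/mem_set; exists (g, h) => //=.
  by split=> //; exact: set_mem.
move: xUV; rewrite inE => -[[g h] /= [Ug Vh gh] ghx].
rewrite -(@fsbig_widen _ _ _ _ [set (g, h)]).
- by rewrite fsbig_set1 /= !indicE !mem_set// mulr1.
- by move=> _ ->.
move=> [g' h'] /= [[gh' ghx'] neq]; rewrite !indicE -natrM mulnb.
have [/andP[]|//] := boolP (_ && _); rewrite !inE => Ug' Vh'.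
case: neq; congr pair.
- by apply: Ur; rewrite ?inE// -(rng_gmul gh') ghx' -ghx rng_gmul.
- by apply: Vs; rewrite ?inE// -(src_gmul gh') ghx' -ghx src_gmul.
Qed.

End Steinberg.

Arguments convolution : clear implicits.
Arguments steinberg : clear implicits.
Arguments steinberg_component {G} K {H} c h.
Arguments ample_hausdorff : clear implicits.

(* Main.v *)
Require Import Defs.
From mathcomp Require Import all_boot all_order all_algebra.
From mathcomp Require Import all_classical topology numfun.

Set Implicit Arguments.
Unset Strict Implicit.
Unset Printing Implicit Defensive.

Import GRing.Theory.

Local Open Scope classical_set_scope.
Local Open Scope ring_scope.

(** A closed invariant set [W] of units gives a graded ideal, namely the kernel
  [vanishing_ideal W] of the restriction of functions from [G] to [G|_W], and the
  quotient by it is the Steinberg algebra of [G|_W]. Since compact open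
  bisections separate points, a space of functions of this kind is finite
  dimensional if and only if its domain is finite
  ([finite_of_finite_dim_quotient], [finite_dim_quotient_of_finite]). When [W] is
  proper the ideal is nonzero, so in a graded just infinite algebra [G|_W] has
  to be finite.

  Conversely, a nonzero graded ideal [J] contains the indicator of a nonempty
  compact open set of units ([ideal_contains_indic]). To see this, multiply a
  nonzero homogeneous element of [J] by the indicator of an inverse bisection;
  this gives an element [a] of degree [1] with [a u != 0] at a unit [u]. As
  [c^-1(1)] is effective, there are arbitrarily small nonempty open sets [V] of
  units near [u] such that no arrow in the support of [a], other than a unit, has
  both its range and its source in [V]; then [\1_V * a * \1_V] is a nonzero
  multiple of [\1_V].

  Let [U] be the union of all compact open sets of units whose indicator is in
  [J]. It is open, invariant and nonempty, so its complement [W] in the unit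
  space is proper, closed and invariant, and [G|_W] is finite by hypothesis. An
  element of the algebra that vanishes on [G|_W] has the sources of its compact
  support in [U], hence equals its product with some [\1_V] in [J]
  ([ideal_contains_supported]). So [J] contains [vanishing_ideal W], and the
  quotient by [J] is also a quotient of a space of functions on the finite set
  [G|_W]. *)

(** * Compactness *)

(** The union of a finite subcover is again a member of the family, so that a
  single member covers. *)
Lemma compact_directed_cover (T : topologicalType) (C : set T)
    (P : set T -> Prop) : compact C ->
  P set0 -> (forall V W, P V -> P W -> P (V `|` W)) ->
  (forall x, C x -> exists2 V, P V & nbhs x V) ->
  exists2 V, P V & C `<=` V.
Proof.
move=> /compact_near_coveringP cC P0 PU Pn.
(* Eventually along [F] means for all supersets of some member of [P]. *)
pose F := filter_from P (fun V => [set W | V `<=` W]).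
have FF : Filter F.
  apply: filter_from_filter; first by exists set0.
  move=> V W PV PW; exists (V `|` W); first exact: PU.
  by move=> X VWX; split; apply: subset_trans VWX; [left|right].
have [x Cx|V PV CV] := cC _ F (fun V x => V x) FF.
  have [V PV nV] := Pn x Cx.
  exists (V, [set W | V `<=` W]); first by split=> //=; exists V.
  by move=> [y W] /= [Vy VW]; exact: VW.
by exists V => //; exact: CV.
Qed.

(** * Groupoid algebra and topology *)

Section GroupoidAlgebra.
Context {G : topGroupoid}.
Implicit Types g h : G.

Lemma unit_spaceP g : unit_space g <-> rng g = g.
Proof. by split=> [[h _ <-]|gE]; [rewrite rng_rng|exists g]. Qed.

Lemma src_unit g : unit_space g -> src g = g.
Proof. by move=> /unit_spaceP gE; rewrite -[in LHS]gE src_rng. Qed.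

Lemma unit_rng g : unit_space (rng g).
Proof. by exists g. Qed.

Lemma unit_src g : unit_space (src g).
Proof. by apply/unit_spaceP; rewrite rng_src. Qed.

Lemma ginvK g : ginv (ginv g) = g.
Proof.
rewrite -[LHS]gmul_src src_ginv rng_ginv -(gmulVg g).
by rewrite gmulA ?src_ginv ?rng_ginv// gmulVg src_ginv gmul_rng.
Qed.

Lemma gmulK g h : src g = rng h -> gmul (ginv g) (gmul g h) = h.
Proof.
by move=> gh; rewrite gmulA ?src_ginv// gmulVg gh gmul_rng.
Qed.

Lemma gmulVK g h : rng g = rng h -> gmul g (gmul (ginv g) h) = h.
Proof.
by move=> gh; rewrite gmulA ?src_ginv ?rng_ginv// gmulV gh gmul_rng.
Qed.

End GroupoidAlgebra.

Section GroupoidTopology.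
Context {G : topGroupoid} (G_ample : ample_hausdorff G).
Implicit Types (g h x y : G) (U V W B : set G).

Lemma rng_continuous : continuous (@rng G).
Proof.
have [_ _ [_ loc] _] := G_ample => x.
have [U [[oU Ux] _ + _]] := loc x.
by rewrite continuous_open_subspace// => /(_ x); apply; exact: mem_set.
Qed.

Lemma src_continuous : continuous (@src G).
Proof.
have -> : @src G = @rng G \o @ginv G by apply/funext => x /=; rewrite rng_ginv.
by move=> x; apply: continuous_comp; [exact: ginv_continuous|exact: rng_continuous].
Qed.

Lemma open_rng_preimage U : open U -> open (@rng G @^-1` U).
Proof. by apply: open_comp => x _; exact: rng_continuous. Qed.

Lemma open_src_preimage U : open U -> open (@src G @^-1` U).
Proof. by apply: open_comp => x _; exact: src_continuous. Qed.

Lemma hausdorff_sep x y : x <> y ->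
  exists P Q, [/\ open P, open Q, P x, Q y & forall z, P z -> Q z -> False].
Proof.
have [_ + _ _] := G_ample; rewrite open_hausdorff => sep /eqP /sep.
case=> -[P Q] /= [/set_mem Px /set_mem Qy] [oP oQ /eqP PQ].
exists P, Q; split=> // z Pz Qz.
by have : (P `&` Q) z by []; rewrite PQ.
Qed.

Lemma closed_equalizer (T : topologicalType) (f k : T -> G) :
  continuous f -> continuous k -> closed [set x | f x = k x].
Proof.
move=> cf ck; rewrite -openC openE => x /= /hausdorff_sep [P [Q [oP oQ Px Qx PQ]]].
have nP : nbhs x (f @^-1` P) by apply: cf; exact: open_nbhs_nbhs.
have nQ : nbhs x (k @^-1` Q) by apply: ck; exact: open_nbhs_nbhs.
apply: filterS (filterI nP nQ) => y /= [Py Qy] fk.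
by apply: (PQ (f y)) => //; rewrite fk.
Qed.

(** A neighbourhood of a unit [u] on which the range map is injective contains
  [rng g] along with [g] for [g] near [u], and then [rng g = g]. *)
Lemma unit_space_open : open (@unit_space G).
Proof.
have [_ _ [_ loc] _] := G_ample.
rewrite openE => u /unit_spaceP uE.
have [U [[oU Uu] injU _ _]] := loc u.
have : nbhs u (U `&` @rng G @^-1` U).
  apply: open_nbhs_nbhs; split; last by split=> //=; rewrite uE.
  by apply: openI => //; exact: open_rng_preimage.
apply: filterS => g [Ug /= Urg]; apply/unit_spaceP.
by apply: injU; rewrite ?inE// rng_rng.
Qed.

Lemma unit_space_closed : closed (@unit_space G).
Proof.
have -> : @unit_space G = [set g | rng g = id g].
  by apply/seteqP; split=> g /unit_spaceP.
by apply: closed_equalizer; [exact: rng_continuous|move=> x].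
Qed.

Lemma rng_open U : open U -> open (@rng G @` U).
Proof.
have [_ _ [_ loc] _] := G_ample => oU.
rewrite openE => _ [x Ux <-].
have [V [[oV Vx] _ _ opn]] := loc x.
have := opn (U `&` V) (@subIsetr _ _ _) (openI oU oV).
rewrite -(open_setIS _ unit_space_open) => oUV.
apply: (@filterS _ _ _ (@rng G @` (U `&` V) `&` @unit_space G)).
  by move=> _ [[y [Uy _] <-] _]; exists y.
by apply: open_nbhs_nbhs; split=> //; split=> //; [exists x|exact: unit_rng].
Qed.

(** For bisections, the set whose indicator is [\1_U * \1_V]. *)
Definition gmul_set U V : set G :=
  [set gmul p.1 p.2 | p in [set p | [/\ U p.1, V p.2 & src p.1 = rng p.2]]].

(** Near [g h] every arrow [y] factors as [g' (g'^-1 y)] with [g'] near [g] and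
  with the range of [y], because the range map is open; and [g'^-1 y] is then
  near [h] by continuity of the product. *)
Lemma gmul_set_open U V : open U -> open V -> open (gmul_set U V).
Proof.
move=> oU oV; rewrite openE => _ [[g h] /= [Ug Vh gh] <-].
have cont := @gmul_continuous G; rewrite subspace_continuousP in cont.
have /cont cgh : [set p : G * G | src p.1 = rng p.2] (ginv g, gmul g h).
  by rewrite /= src_ginv rng_gmul.
have : nbhs (gmul (ginv g) (gmul g h)) V.
  by apply: open_nbhs_nbhs; rewrite gmulK.
move=> /cgh; rewrite /nbhs/= /within/= => -[[P Q] /= [nP nQ] PQ].
have nU : nbhs g (U `&` (@ginv G) @^-1` P).
  apply: filterI; first exact: open_nbhs_nbhs.
  exact: (@ginv_continuous G g).
have nR : nbhs (gmul g h) (@rng G @^-1` (@rng G @` (U `&` (@ginv G) @^-1` P))).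
  have [O [oO Og] OU] : exists2 O, open_nbhs g O & O `<=` U `&` (@ginv G) @^-1` P.
    by move: nU; rewrite nbhsE => -[O oO OU]; exists O.
  apply: (@filterS _ _ _ (@rng G @^-1` (@rng G @` O))).
    by move=> z [o Oo oz]; exists o => //; exact: OU.
  apply: open_nbhs_nbhs; split; first exact/open_rng_preimage/rng_open.
  by exists g => //; rewrite rng_gmul.
apply: filterS (filterI nQ nR) => y [Qy [g' [Ug' Pg'] g'y]].
exists (g', gmul (ginv g') y); last by rewrite /= gmulVK.
split=> //=; last by rewrite rng_gmul ?rng_ginv// src_ginv.
by apply: (PQ (ginv g', y)) => //=; rewrite src_ginv.
Qed.

Lemma gmul_set_compact U V : compact U -> compact V -> compact (gmul_set U V).
Proof.
move=> cU cV.
have -> : gmul_set U V = (fun p : G * G => gmul p.1 p.2) @`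
    ((U `*` V) `&` [set p : G * G | src p.1 = rng p.2]).
  by apply/seteqP; split=> _ [p Hp <-]; exists p => //; case: Hp => [] // [].
apply: continuous_compact.
  by apply: continuous_subspaceW (@gmul_continuous G) => p [].
apply: compact_closedI; first exact: compact_setX.
apply: closed_equalizer => p; apply: continuous_comp.
- exact: cvg_fst.
- exact: src_continuous.
- exact: cvg_snd.
- exact: rng_continuous.
Qed.

Lemma gmul_set_bisection U V :
  bisection U -> bisection V -> bisection (gmul_set U V).
Proof.
move=> [Ur Us] [Vr Vs]; split=> x y /set_mem [[g h] /= [Ug Vh gh] <-]
  /set_mem [[g' h'] /= [Ug' Vh' gh'] <-].
  rewrite !rng_gmul// => rE.
  have E : g = g' by apply: Ur; rewrite ?inE.
  by rewrite E; congr gmul; apply: Vr; rewrite ?inE// -gh -gh' E.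
rewrite !src_gmul// => sE.
have E : h = h' by apply: Vs; rewrite ?inE.
by rewrite E; congr gmul; apply: Us; rewrite ?inE// gh gh' E.
Qed.

Lemma gmul_set_cob U V : compact_open_bisection U -> compact_open_bisection V ->
  compact_open_bisection (gmul_set U V).
Proof.
move=> [cU oU bU] [cV oV bV]; split; first exact: gmul_set_compact.
  exact: gmul_set_open.
exact: gmul_set_bisection.
Qed.

Lemma ginv_cob U : compact_open_bisection U ->
  compact_open_bisection (@ginv G @^-1` U).
Proof.
move=> [cU oU [rU sU]]; split.
- have -> : @ginv G @^-1` U = @ginv G @` U.
    by apply/seteqP; split=> [x Ux|_ [x Ux <-]];
      [exists (ginv x); rewrite ?ginvK|rewrite /= ginvK].
  by apply: continuous_compact => //; exact/continuous_subspaceT/ginv_continuous.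
- by apply: open_comp => // x _; exact: ginv_continuous.
- split=> x y /set_mem /= Ux /set_mem /= Uy xy; rewrite -(ginvK x) -(ginvK y).
  + by congr ginv; apply: sU; rewrite ?inE// !src_ginv.
  + by congr ginv; apply: rU; rewrite ?inE// !rng_ginv.
Qed.

Lemma cob_basis g U : open U -> U g ->
  exists B, [/\ compact_open_bisection B, B g & B `<=` U].
Proof.
move=> oU Ug; have [_ _ _ [_ bas]] := G_ample.
by have [|B [cB Bg] BU] := bas g U; [exact: open_nbhs_nbhs|exists B].
Qed.

Lemma cob_closed U : compact_open_bisection U -> closed U.
Proof. by have [_ hG _ _] := G_ample; move=> [cU _ _]; exact: compact_closed. Qed.

Lemma cob_clopenI U V : compact_open_bisection U -> open V -> closed V ->
  compact_open_bisection (U `&` V).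
Proof.
move=> [cU oU [rU sU]] oV cV; split; first exact: compact_closedI.
  exact: openI.
split=> x y /set_mem [Ux _] /set_mem [Uy _] xy.
- by apply: rU; rewrite ?inE.
- by apply: sU; rewrite ?inE.
Qed.

Lemma finite_closed (F : set G) : finite_set F -> closed F.
Proof.
have [_ hG _ _] := G_ample.
by have /accessible_finite_set_closed := hausdorff_accessible hG; exact.
Qed.

End GroupoidTopology.

(** * Linear spans *)

Section LinearSpan.
Context {K : fieldType} {V : lmodType K}.
Implicit Types (X : set V) (P : V -> Prop).

Lemma lin_span_ind X P : P 0 ->
  (forall (k : K) u v, X u -> P v -> P (k *: u + v)) ->
  forall v, lin_span X v -> P v.
Proof.
move=> P0 PD _ [n [k [u [Xu ->]]]].
by elim/big_rec : _ => // i v _ Pv; exact: PD.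
Qed.

Lemma lin_span_gen X v : X v -> lin_span X v.
Proof.
move=> Xv; exists 1%N, (fun=> 1), (fun=> v); split=> //.
by rewrite big_ord1 scale1r.
Qed.

Lemma lin_span0 X : lin_span X 0.
Proof.
exists 0%N, (fun=> 0), (fun=> 0); split; first by case.
by rewrite big_ord0.
Qed.

Lemma lin_span_linear X (k : K) v w :
  lin_span X v -> lin_span X w -> lin_span X (k *: v + w).
Proof.
move=> [n [a [u [Xu ->]]]] [m [b [t [Xt ->]]]].
exists (n + m)%N, (fun i : 'I_(n + m) =>
    match fintype.split i with inl j => k * a j | inr j => b j end),
  (fun i : 'I_(n + m) =>
     match fintype.split i with inl j => u j | inr j => t j end); split.
  by move=> i; case: (fintype.split i).
rewrite big_split_ord scaler_sumr; congr (_ + _); apply: eq_bigr => i _.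
- by rewrite (unsplitK (inl i)) scalerA.
- by rewrite (unsplitK (inr i)).
Qed.

End LinearSpan.

(** If the span of [s] separates the points of every finite subset [F] of [S],
  then evaluation at the points of [F] maps it onto [K ^ F], so that [F] has at
  most [size s] elements. *)
Lemma finite_set_of_span (K : fieldType) (T : choiceType) (S : set T)
    (s : seq (T -> K^o)) :
  (forall F : set T, finite_set F -> F `<=` S -> forall t, F t ->
     exists2 v, lin_span [set` s] v & forall x, F x -> v x = (x == t)%:R) ->
  finite_set S.
Proof.
move=> sep; apply: contrapT => /(infinite_set_fset (size s).+1)[F FS].
set m := size (finmap.enum_fset F) => ltsm.
pose t (j : 'I_m) : T := tnth (in_tuple (finmap.enum_fset F)) j.
have Ft j : t j \in finmap.enum_fset F by exact: mem_tnth.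
have tinj : injective t.
  by apply/tuple_uniqP; exact: finmap.fset_uniq.
(* Its row space consists of the restrictions of the span of [s] to [F]. *)
pose M := \matrix_(i < size s, j < m) (nth 0 s i (t j) : K).
have spanM (v : T -> K^o) : lin_span [set` s] v -> (\row_j (v (t j) : K) <= M)%MS.
  move: v; apply: lin_span_ind.
    suff -> : \row_j ((0 : T -> K^o) (t j) : K) = 0 by exact: sub0mx.
    by apply/rowP => j; rewrite !mxE.
  move=> k u w /= us wM.
  have -> : \row_j ((k *: u + w) (t j) : K) =
      k *: \row_j (u (t j) : K) + \row_j (w (t j) : K).
    by apply/rowP => j; rewrite !mxE.
  apply: addmx_sub => //; apply: scalemx_sub.
  have iu : (index u s < size s)%N by rewrite index_mem.
  have -> : \row_j (u (t j) : K) = row (Ordinal iu) M.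
    by apply/rowP => j; rewrite !mxE nth_index.
  exact: row_sub.
have : (1%:M <= M)%MS.
  apply/row_subP => j.
  have [v /spanM vM vE] := sep _ (finite_fset F) FS _ (Ft j).
  suff -> : row j 1%:M = \row_j (v (t j) : K) by [].
  apply/rowP => i; rewrite !mxE vE; last exact: Ft.
  by rewrite (inj_eq tinj) eq_sym.
move=> /mxrankS; rewrite mxrank1 => /leq_trans /(_ (rank_leq_row _)).
by rewrite leqNgt ltsm.
Qed.

(** * The Steinberg algebra as an algebra of locally constant functions *)

Section SteinbergAlgebra.
Context {G : topGroupoid} (G_ample : ample_hausdorff G) (K : fieldType).
Implicit Types (g x y : G) (U V B S : set G) (f a b : G -> K^o).
Local Notation A := (steinberg G K).
Local Notation conv := (convolution G K).

Lemma indic_out U x : ~ U x -> (\1_U : G -> K^o) x = 0.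
Proof. by move=> Ux; rewrite indicE memNset. Qed.

Lemma indic_in U x : U x -> (\1_U : G -> K^o) x = 1.
Proof. by move=> Ux; rewrite indicE mem_set. Qed.

Lemma steinberg_indic B : compact_open_bisection B -> A \1_B.
Proof. by move=> cB; apply: lin_span_gen; exists B. Qed.

Lemma steinberg_ind (P : (G -> K^o) -> Prop) : P 0 ->
  (forall (k : K) B f, compact_open_bisection B -> A f -> P f ->
    P (k *: (\1_B : G -> K^o) + f)) ->
  forall f, A f -> P f.
Proof.
move=> P0 PD f Af; suff [] : A f /\ P f by [].
move: f Af; apply: lin_span_ind; first by split=> //; exact: lin_span0.
move=> k _ v [B cB <-] [Av Pv]; split; last exact: PD.
by apply: lin_span_linear => //; exact: steinberg_indic.
Qed.

Lemma steinberg_locally_constant f x : A f -> \forall y \near x, f y = f x.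
Proof.
move=> Af; move: f Af; apply: steinberg_ind; first exact: nearW.
move=> k B f cB _ fx; have [_ oB _] := cB.
have : \forall y \near x, (\1_B : G -> K^o) y = (\1_B : G -> K^o) x.
  have [Bx|Bx] := pselect (B x).
    apply: (@filterS _ _ _ B); last exact: open_nbhs_nbhs.
    by move=> y By; rewrite !indic_in.
  apply: (@filterS _ _ _ (~` B)).
    by move=> y By; rewrite !indic_out.
  by apply: open_nbhs_nbhs; split=> //; exact/closed_openC/(cob_closed G_ample cB).
move=> Bc; apply: filterS (filterI Bc fx) => y [].
by rewrite !fctE => -> ->.
Qed.

(** The support lies in a finite union of compact bisections, and it is closed
  because [f] is locally constant. *)
Lemma steinberg_compact_support f : A f -> compact [set x | f x <> 0].
Proof.
move=> Af.
have [C cC sC] : exists2 C, compact C & [set x | f x <> 0] `<=` C.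
  move: f Af; apply: steinberg_ind.
    by exists set0; [exact: compact0|move=> x].
  move=> k B f [cB _ _] _ [C cC sC]; exists (B `|` C); first exact: compactU.
  move=> x /= nz; have [Bx|Bx] := pselect (B x); [by left|right].
  by apply: sC => /= fx0; apply: nz; rewrite !fctE fx0 indic_out// scaler0 addr0.
apply: subclosed_compact cC sC; rewrite -openC openE => x /= nx.
have fx : f x = 0 by apply: contrapT.
apply: filterS (steinberg_locally_constant x Af) => y.
by rewrite fx => fy0 /=; apply.
Qed.

(** This makes the sum defining the convolution finite: a factorization of [x] is
  determined by its first factor, whose range is [rng x]. *)
Lemma steinberg_fiber_finite f y : A f -> finite_set [set x | f x <> 0 /\ rng x = y].
Proof.
move: f; apply: steinberg_ind.
  by rewrite (_ : [set _ | _] = set0)//; apply/seteqP; split=> // x [].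
move=> k B f [_ _ [rB _]] _ fin.
apply: (@sub_finite_set _ _ ((B `&` [set x | rng x = y]) `|`
    [set x | f x <> 0 /\ rng x = y])).
  move=> x /= [nz xy]; have [Bx|Bx] := pselect (B x); [by left|right; split=> //].
  by move=> fx0; apply: nz; rewrite !fctE fx0 indic_out// scaler0 addr0.
rewrite finite_setU; split=> //.
have [[x0 [Bx0 <-]]|no] := pselect (exists x, B x /\ rng x = y).
  apply: (@sub_finite_set _ _ [set x0]) => // x [Bx xx0].
  by apply: rB; rewrite ?inE.
rewrite (_ : _ `&` _ = set0)//; apply/seteqP; split=> // x [Bx xy].
by apply: no; exists x.
Qed.

Lemma convolution_linearl (k : K) a b f : A a -> A b ->
  conv (k *: a + b) f = k *: conv a f + conv b f.
Proof.
move=> Aa Ab; apply/funext => x.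
(* A common finite index set for the three sums. *)
pose D := [set p : G * G | (src p.1 = rng p.2 /\ gmul p.1 p.2 = x) /\
  (a p.1 <> 0 \/ b p.1 <> 0)].
have fD : finite_set D.
  apply: (@sub_finite_set _ _ ((fun g => (g, gmul (ginv g) x)) @`
      ([set g | a g <> 0 /\ rng g = rng x] `|` [set g | b g <> 0 /\ rng g = rng x]))).
    move=> [g h] /= [[gh <-] nz]; exists g; last by rewrite gmulK.
    by rewrite rng_gmul//; case: nz; [left|right].
  by apply: finite_image; rewrite finite_setU; split; exact: steinberg_fiber_finite.
have widen (e : G -> K^o) : (forall p, a p = 0 -> b p = 0 -> e p = 0) ->
    conv e f x = \sum_(p \in D) (e p.1 * f p.2 : K).
  move=> e0; rewrite /convolution; apply/esym/fsbig_widen; first by move=> p [].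
  move=> p [Sp nD] /=.
  rewrite e0 ?mul0r//; apply: contrapT => nz; apply: nD; split=> //; by [left|right].
rewrite widen; last by move=> p; rewrite !fctE => -> ->; rewrite scaler0 addr0.
rewrite !fctE (widen a)// (widen b)//.
rewrite -[_ *: _]/(k * _ : K) mulr_fsumr -fsbig_split//.
apply: eq_fsbigr => p _. by rewrite -[k *: _]/(k * _ : K) mulrDl mulrA.
Qed.

(** For a bisection [B] at most one factorization of [x] starts in [B]; it
  then starts with [g]. The next lemma is the case in which there is none. *)
Lemma convolution_indicl B f g x : bisection B -> B g -> rng g = rng x ->
  conv \1_B f x = f (gmul (ginv g) x).
Proof.
move=> [rB _] Bg gx; rewrite /convolution.
rewrite -(@fsbig_widen _ _ _ _ [set (g, gmul (ginv g) x)]).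
- by rewrite fsbig_set1 /= indic_in// mul1r.
- by move=> _ ->; rewrite /= rng_gmul ?src_ginv// rng_ginv gmulVK.
- move=> [g' h'] /= [[gh' ghx'] neq].
  have [Bg'|Bg'] := pselect (B g'); last by rewrite indic_out// mul0r.
  case: neq; have gg' : g' = g.
    by apply: rB; rewrite ?inE// gx -ghx' rng_gmul.
  by rewrite gg' -ghx' -gg' gmulK.
Qed.

Lemma convolution_indicl0 B f x : (forall g, B g -> rng g <> rng x) ->
  conv \1_B f x = 0.
Proof.
move=> nB; apply: fsbig1 => -[g h] /= [gh ghx].
rewrite indic_out ?mul0r// => /nB; apply.
by rewrite -ghx rng_gmul.
Qed.

Lemma convolution_unitl V f x : V `<=` unit_space ->
  conv \1_V f x = (\1_V : G -> K^o) (rng x) * f x.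
Proof.
move=> Vu; have bV : bisection V.
  by split=> y z /set_mem/Vu yu /set_mem/Vu zu;
    [rewrite !(unit_spaceP _).1|rewrite !src_unit].
have [Vx|Vx] := pselect (V (rng x)).
  rewrite (@convolution_indicl _ _ (rng x))// ?rng_rng//.
  rewrite indic_in// mul1r -[X in gmul _ X](gmul_rng x) gmulK ?gmul_rng//.
  by rewrite src_rng.
rewrite indic_out// mul0r convolution_indicl0// => g Vg gx.
by apply: Vx; rewrite -gx (unit_spaceP _).1//; exact: Vu.
Qed.

Lemma convolution_unitr V f x : V `<=` unit_space ->
  conv f \1_V x = f x * (\1_V : G -> K^o) (src x).
Proof.
move=> Vu; rewrite /convolution.
rewrite -(@fsbig_widen _ _ _ _ [set (x, src x)]).
- by rewrite fsbig_set1.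
- by move=> _ -> /=; rewrite rng_src gmul_src.
- move=> [g h] /= [[gh ghx] neq].
  have [Vh|Vh] := pselect (V h); last by rewrite indic_out// mulr0.
  have hu := (unit_spaceP _).1 (Vu _ Vh).
  have ghE : gmul g h = g by rewrite -hu -gh gmul_src.
  by case: neq; rewrite -ghx ghE gh hu.
Qed.

(** Linearity in the first factor reduces the claim to an indicator [\1_B], and
  convolution by [\1_B] is linear in the second factor because it is evaluation
  at a single arrow. *)
Lemma convolution_closed a f : A a -> A f -> A (conv a f).
Proof.
move=> Aa Af; move: a Aa; apply: steinberg_ind.
  rewrite (_ : conv 0 f = 0); first exact: lin_span0.
  by apply/funext => x; apply: fsbig1 => p _; rewrite mul0r.
move=> k B a cB Aa IH; rewrite convolution_linearl//; last exact: steinberg_indic.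
apply: lin_span_linear => // {k a Aa IH}.
have [_ _ bB] := cB; move: f Af; apply: steinberg_ind.
  rewrite (_ : conv _ 0 = 0); first exact: lin_span0.
  by apply/funext => x; apply: fsbig1 => p _; rewrite mulr0.
move=> k C f cC Af IH.
rewrite (_ : conv _ _ = k *: conv \1_B \1_C + conv \1_B f).
  apply: lin_span_linear => //; rewrite convolution_indic//; last by case: cC.
  by apply: steinberg_indic; exact: gmul_set_cob.
apply/funext => x; rewrite !fctE.
have [[g [Bg gx]]|no] := pselect (exists g, B g /\ rng g = rng x).
  by rewrite !(@convolution_indicl _ _ g).
have nB g : B g -> rng g <> rng x by move=> Bg gx; apply: no; exists g.
by rewrite !convolution_indicl0// scaler0 addr0.
Qed.

(** The witness is the indicator of a compact open bisection around [x] that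
  misses the other points of [F]. *)
Lemma steinberg_separates (F : set G) x : finite_set F ->
  exists2 f, A f & forall y, F y -> f y = (y == x)%:R.
Proof.
move=> finF; have [||B [cB Bx BF]] := cob_basis G_ample (g := x) (U := ~` (F `\ x)).
- by apply: closed_openC; apply: (finite_closed G_ample); exact: finite_setD.
- by move=> [_]; apply.
exists \1_B; first exact: steinberg_indic.
move=> y Fy; have [->|/eqP yx] := eqVneq; first by rewrite indic_in.
by rewrite indic_out// => /BF; apply.
Qed.

(** Restriction to [S] factors through the quotient by [J], so that finitely many
  functions span all restrictions to [S], which include the indicators of the
  points of any finite subset. *)
Lemma finite_of_finite_dim_quotient S (J : set (G -> K^o)) :
  (forall f, J f -> forall x, S x -> f x = 0) -> finite_dim_quotient A J ->
  finite_set S.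
Proof.
move=> JS [s _ AsJ]; apply: (@finite_set_of_span K G S s) => F fF FS t Ft.
have [f Af fE] := steinberg_separates t fF.
have [v vs [w Jw vw]] := AsJ _ Af; exists v => // x Fx.
by rewrite -fE// -vw !fctE (JS w)// ?addr0//; exact: FS.
Qed.

(** For each [x] in the finite set [S] choose [e x] in the algebra restricting to
  the indicator of [x] on [S]. Modulo [J], every [f] is then the combination of
  the [e x] with coefficients [f x]. *)
Lemma finite_dim_quotient_of_finite S (J : set (G -> K^o)) : finite_set S ->
  (forall f, A f -> (forall x, S x -> f x = 0) -> J f) ->
  finite_dim_quotient A J.
Proof.
move=> finS SJ.
have /choice[e eP] : forall x, exists e : G -> K^o,
    A e /\ forall y, S y -> e y = (y == x)%:R.
  by move=> x; have [e Ae eE] := steinberg_separates x finS; exists e.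
have /finite_seqP[r rS] := finS.
pose s := [seq e x | x <- undup r].
exists s; first by move=> f /= /mapP[x _ ->]; have [] := eP x.
move=> f Af; pose v := \sum_(x <- undup r) (f x : K) *: e x.
have spanv (P : set (G -> K^o)) : {in r, forall x, P (e x)} -> lin_span P v.
  move=> Pe; rewrite /v big_seq; elim/big_rec : _; first exact: lin_span0.
  move=> x w; rewrite mem_undup => xr Pw.
  by apply: lin_span_linear => //; apply: lin_span_gen; exact: Pe.
exists v; first by apply: spanv => x xr /=; apply: map_f; rewrite mem_undup.
have Av : A v.
  rewrite /v; elim/big_rec : _; first exact: lin_span0.
  by move=> x w _ Aw; apply: lin_span_linear => //; have [] := eP x.
exists ((-1) *: v + f); last by rewrite scaleN1r addrA subrr add0r.
apply: SJ; first exact: lin_span_linear.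
move=> x Sx; rewrite !fctE.
suff -> : v x = f x by rewrite scaleN1r addNr.
have xr : x \in undup r by rewrite mem_undup; move: Sx; rewrite rS.
rewrite /v fct_sumE (bigD1_seq x)//= ?undup_uniq// big1_seq ?addr0.
  by rewrite fctE (eP x).2// eqxx -[_ *: _]/(f x * 1) mulr1.
move=> y /andP[yx _]; rewrite fctE (eP y).2//.
by rewrite eq_sym (negbTE yx) scaler0.
Qed.

End SteinbergAlgebra.

(** * The grading induced by a cocycle *)

Section Grading.
Context {G : topGroupoid} (G_ample : ample_hausdorff G) (K : fieldType).
Context {H : groupType} {c : G -> H} (c_cocycle : cocycle c).
Context (c_continuous : continuous (c : G -> discrete_topology H)).
Implicit Types (g x y : G) (U V W B S : set G) (f a : G -> K^o) (h : H).
Local Notation A := (steinberg G K).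
Local Notation conv := (convolution G K).
Local Notation Ah := (steinberg_component K c).

Lemma cocycle_unit g : unit_space g -> c g = 1%g.
Proof.
move=> gu; have sg := src_unit gu; have rg := (unit_spaceP g).1 gu.
have gg : gmul g g = g by rewrite -[X in gmul g X]sg gmul_src.
by apply: (@mulgI _ (c g)); rewrite -c_cocycle ?sg ?rg// gg mulg1.
Qed.

Lemma fiber_open h : open (c @^-1` [set h]).
Proof.
apply: (@open_comp G (discrete_topology H) c [set h]).
  by move=> x _; exact: c_continuous.
exact: discrete_open.
Qed.

Lemma fiber_closed h : closed (c @^-1` [set h]).
Proof.
apply: (@preimage_closed G (discrete_topology H) c [set h]).
  by move=> x _; exact: c_continuous.
exact: discrete_closed.
Qed.

Definition component f h : G -> K^o :=
  fun x => (\1_(c @^-1` [set h]) : G -> K^o) x * f x.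

Lemma component_in f h x : c x = h -> component f h x = f x.
Proof. by move=> xh; rewrite /component indic_in// mul1r. Qed.

Lemma component_out f h x : c x <> h -> component f h x = 0.
Proof. by move=> xh; rewrite /component indic_out// mul0r. Qed.

Lemma component_steinberg f h : A f -> Ah h (component f h).
Proof.
move: f; apply: steinberg_ind.
  rewrite (_ : component 0 h = 0); first exact: lin_span0.
  by apply/funext => x; rewrite /component mulr0.
move=> k B f cB _ IH.
rewrite (_ : component _ h =
    k *: (\1_(B `&` c @^-1` [set h]) : G -> K^o) + component f h).
  apply: lin_span_linear => //; apply: lin_span_gen.
  exists (B `&` c @^-1` [set h]) => //; split; last by move=> x [].
  by apply: cob_clopenI => //; [exact: fiber_open|exact: fiber_closed].
apply/funext => x.
have [xh|xh] := pselect (c x = h).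
  rewrite [LHS]component_in// !fctE component_in//.
  by rewrite !indicE in_setI [X in _ && X]mem_set// andbT.
rewrite !fctE.
by rewrite !component_out// indic_out ?scaler0 ?addr0// => -[].
Qed.

Lemma componentP f h : Ah h f <-> A f /\ forall x, c x <> h -> f x = 0.
Proof.
split=> [|[Af f0]]; last first.
  rewrite (_ : f = component f h); first exact: component_steinberg.
  apply/funext => x; have [xh|xh] := pselect (c x = h).
    by rewrite component_in.
  by rewrite component_out// f0.
move: f; apply: lin_span_ind; first by split=> //; exact: lin_span0.
move=> k _ f [B [cB Bh] <-] [Af f0]; split.
  by apply: lin_span_linear => //; exact: steinberg_indic.
by move=> x xh; rewrite !fctE f0// addr0 indic_out ?scaler0// => /Bh.
Qed.

(** The cocycle maps each compact bisection carrying [f] onto a compact subset of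
  the discrete group, and such a subset is finite. *)
Lemma finite_degrees f : A f -> finite_set [set h | component f h != 0].
Proof.
move=> Af; apply: (@sub_finite_set _ _ (c @` [set x | f x <> 0])).
  move=> h /= /eqP nz; apply: contrapT => no; apply: nz.
  apply/funext => x; have [xh|xh] := pselect (c x = h); last exact: component_out.
  rewrite component_in//; apply: contrapT => fx; apply: no; by exists x.
move: f Af; apply: steinberg_ind.
  by rewrite (_ : [set x | _] = set0) ?image_set0//; apply/seteqP; split=> // x.
move=> k B f [cB _ _] _ IH.
apply: (@sub_finite_set _ _ ((c @` B) `|` (c @` [set x | f x <> 0]))).
  move=> _ [x nz <-]; have [Bx|Bx] := pselect (B x); [by left; exists x|right].
  exists x => //= fx0; apply: nz; by rewrite !fctE fx0 indic_out// scaler0 addr0.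
rewrite finite_setU; split=> //.
have : compact (c @` B : set (discrete_topology H)).
  by apply: continuous_compact => //; exact: continuous_subspaceT.
move=> /(@compact_directed_cover (discrete_topology H) _ finite_set).
case=> [//|V W fV fW|h _|V fV BV]; first by rewrite finite_setU.
  by exists [set h] => //; apply: open_nbhs_nbhs; split=> //; exact: discrete_open.
exact: sub_finite_set BV fV.
Qed.

(** All components of degree other than [c x] vanish at [x]. *)
Lemma sum_components_apply (b : H -> G -> K^o) x : finite_section Ah b ->
  (\sum_(h \in [set: H]) b h) x = b (c x) x.
Proof.
move=> [Ab finb]; pose D := [set h | b h != 0] `|` [set c x].
have finD : finite_set D by rewrite finite_setU.
rewrite -(@fsbig_widen _ _ _ _ D) //; last first.
  by move=> h [_ nD]; apply: contrapT => /eqP nz; apply: nD; left.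
rewrite fsbig_finite// fct_sumE.
rewrite (bigD1_seq (c x)) ?finmap.fset_uniq//=; last first.
  by rewrite in_fset_set// mem_set//; right.
rewrite big1 ?addr0// => h /eqP hx.
by apply: ((componentP _ _).1 (Ab h)).2 => /esym.
Qed.

Lemma component_section f : A f -> finite_section Ah (component f).
Proof.
by move=> Af; split=> [h|]; [exact: component_steinberg|exact: finite_degrees].
Qed.

Lemma sum_components f : A f -> \sum_(h \in [set: H]) component f h = f.
Proof.
move=> Af; apply/funext => x; rewrite sum_components_apply ?component_in//.
exact: component_section.
Qed.

(** * The graded ideal of a closed invariant set *)

(** The functions vanishing on the restriction to a closed invariant set [W]
  form the kernel of the restriction homomorphism onto the Steinberg algebra of
  this restriction. *)
Definition vanishing_ideal W : set (G -> K^o) :=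
  [set f | A f /\ forall x, restriction [set: G] W x -> f x = 0].

Lemma invariantP W x : invariant_in [set: G] W -> W (src x) <-> W (rng x).
Proof.
move=> WE; split=> [Wx|Wx]; rewrite -WE; first by exists x.
by exists (ginv x); [split=> //=; rewrite src_ginv|rewrite rng_ginv].
Qed.

Lemma vanishing_graded_ideal W : invariant_in [set: G] W ->
  is_graded_ideal conv A Ah (vanishing_ideal W).
Proof.
move=> Winv.
have inW x : restriction [set: G] W x <-> W (rng x).
  by split=> [[_ []]//|Wx]; split=> //; split=> //=; apply/(invariantP x Winv).
have idl : is_ideal conv A (vanishing_ideal W).
  split.
  - by move=> f [].
  - by split=> //; exact: lin_span0.
  - move=> k f f' [Af f0] [Af' f0']; split; first exact: lin_span_linear.
    by move=> x Wx; rewrite !fctE f0// f0'// scaler0 addr0.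
  - move=> a f Aa [Af f0].
    split; (split; first exact: convolution_closed) => x /inW Wx;
      apply: fsbig1 => -[y z] /= [yz yzx].
      rewrite [f z]f0 ?mulr0//; apply/inW.
      by rewrite -yz; apply/invariantP => //; move: Wx; rewrite -yzx rng_gmul.
    by rewrite [f y]f0 ?mul0r//; apply/inW; move: Wx; rewrite -yzx rng_gmul.
split=> //; split; last first.
  move=> b [Jb finb] b0 h; apply/funext => x.
  have Ab h' : Ah h' (b h') by have [] := Jb h'.
  have [xh|xh] := pselect (c x = h); last by apply: ((componentP _ _).1 (Ab h)).2.
  by rewrite -xh -sum_components_apply// b0.
apply/seteqP; split=> [f [Af f0]|_ [b [Jb _] ->]].
  exists (component f); last by rewrite sum_components.
  split; last exact: finite_degrees.
  move=> h; have Ch := component_steinberg h Af; split=> //; split.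
    by have [] := (componentP _ _).1 Ch.
  by move=> x Wx; rewrite /component f0// mulr0.
have [_ J0 JD _] := idl.
elim/big_rec : _ => // h f _ Jf.
by rewrite -[b h]scale1r; apply: JD => //; have [] := Jb h.
Qed.

Lemma closed_in_units_closed W : closed_in_units [set: G] W -> closed W.
Proof.
rewrite /closed_in_units /units setTI => -[WU].
rewrite -(closed_setIS _ (unit_space_closed G_ample)).
by rewrite (setIidl WU).
Qed.

(** The ideal [vanishing_ideal W] is nonzero because it contains the indicator of
  a compact open bisection of units around a unit outside [W]. *)
Lemma finite_restriction W : graded_just_infinite conv A Ah ->
  W `<` unit_space -> closed_in_units [set: G] W -> invariant_in [set: G] W ->
  finite_set (restriction [set: G] W).
Proof.
move=> [_ gji] [WU UW] /closed_in_units_closed Wcl Winv.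
apply: (@finite_of_finite_dim_quotient _ G_ample K _ (vanishing_ideal W)).
  by move=> f [].
apply: gji; first exact: vanishing_graded_ideal.
have [u uu Wu] : exists2 u, @unit_space G u & ~ W u.
  apply: contrapT => no; apply: UW => u uu.
  by apply: contrapT => Wu; apply: no; exists u.
have [||B [cB Bu BW]] := cob_basis G_ample (g := u) (U := unit_space `&` ~` W).
- by apply: openI; [exact: unit_space_open|exact: closed_openC].
- by split.
have JB : vanishing_ideal W \1_B.
  split; first exact: steinberg_indic.
  move=> x [_ [_ /= Wx]]; rewrite indic_out// => /BW[xu]; apply.
  by rewrite -((unit_spaceP _).1 xu).
move=> /seteqP[/(_ _ JB) /= /(congr1 (@^~ u)) + _].
by rewrite indic_in// => /eqP; rewrite oner_eq0.
Qed.

(** * Cutting off isotropy with effectiveness *)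

(** If arrows of [B] have range and source in [D], they form an open set without
  units, so by effectiveness one of them, [g], has [rng g <> src g]. Disjoint
  neighbourhoods [P] of [rng g] and [Q] of [src g] then give [E]: it consists of
  ranges in [P] of arrows of [B] with source in [Q], and as [B] is a bisection all
  arrows of [B] with range in [E] have their source in [Q], hence outside [E]. *)
Lemma shrink_unit (S B D : set G) :
  effective S -> open S -> open B -> B `<=` S -> bisection B ->
  (forall g, B g -> ~ unit_space g) ->
  open D -> D !=set0 ->
  exists E, [/\ open E, E !=set0, E `<=` D
    & forall g, B g -> E (rng g) -> E (src g) -> False].
Proof.
move=> effS oS oB BS [rB _] Bu oD D0.
have [[g0 [Bg0 Dr0 Ds0]]|no] :=
    pselect (exists g, [/\ B g, D (rng g) & D (src g)]); last first.
  by exists D; split=> // g Bg Dr Ds; apply: no; exists g.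
pose O := B `&` (@rng G @^-1` D `&` @src G @^-1` D).
have oO : open O.
  apply: openI => //; apply: openI;
    [exact: open_rng_preimage|exact: open_src_preimage].
have [g [Og gne]] : exists g, O g /\ rng g <> src g.
  apply: contrapT => no; apply: (Bu g0 Bg0).
  have : units S g0.
    rewrite -effS; apply: (@filterS _ _ _ (O : set (subspace S))).
      move=> g Og; split; first by apply: BS; case: Og.
      by apply: contrapT => gne; apply: no; exists g.
    by apply: open_nbhs_nbhs; split; [exact: open_subspaceW|split].
  by case.
have [P [Q [oP oQ Pg Qg PQ]]] := hausdorff_sep G_ample gne.
pose O' := O `&` (@rng G @^-1` P `&` @src G @^-1` Q).
have oO' : open O'.
  apply: openI => //; apply: openI;
    [exact: open_rng_preimage|exact: open_src_preimage].
exists (@rng G @` O'); split.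
- exact: rng_open.
- by exists (rng g); exists g.
- by move=> _ [x [[_ [Dx _]] _] <-].
- move=> x Bx [y [[By _] [_ Qy]] yx] [z [_ [Pz _]] zx].
  have xy : x = y by apply: rB; rewrite ?inE.
  apply: (PQ (src x)); first by rewrite -zx.
  by rewrite xy.
Qed.

(** By [shrink_unit], applied to the finitely many bisections carrying the part
  of [f] outside the unit space. *)
Lemma shrink_support (S D : set G) f :
  effective S -> open S -> closed S -> A f -> open D -> D !=set0 ->
  exists E, [/\ open E, E !=set0, E `<=` D & forall g, S g -> f g <> 0 ->
    ~ unit_space g -> E (rng g) -> E (src g) -> False].
Proof.
move=> effS oS cS Af oD D0; move: f Af; apply: steinberg_ind.
  by exists D; split=> // g _ /=.
move=> k B f cB _ [E [oE E0 ED Ef]].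
have [_ oB bB] : compact_open_bisection (B `&` (S `&` ~` unit_space)).
  apply: cob_clopenI => //.
    by apply: openI => //; exact/closed_openC/unit_space_closed.
  by apply: closedI => //; exact/open_closedC/unit_space_open.
have [||E' [oE' E'0 E'E EB]] := shrink_unit effS oS oB _ bB _ oE E0.
- by move=> x [_ []].
- by move=> x [_ []].
exists E'; split=> // [x /E'E /ED//|g Sg nz gu Er Es].
have [Bg|Bg] := pselect (B g); first exact: (EB g).
apply: (Ef g) => //; [|exact: E'E|exact: E'E].
by move=> fg0; apply: nz; rewrite !fctE fg0 indic_out// scaler0 addr0.
Qed.

(** The unit space itself is a closed invariant set, and the restriction to it is
  the whole subgroupoid. *)
Lemma effective_kernel :
  strongly_effective (c @^-1` [set 1%g]) -> effective (c @^-1` [set 1%g]).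
Proof.
set S := c @^-1` _ => se.
have uS : units S = unit_space.
  by apply/seteqP; split=> [x []//|x xu]; split=> //; exact: cocycle_unit.
have rS : restriction S (units S) = S.
  rewrite uS; apply/seteqP; split=> [x []//|x Sx]; split=> //; split=> /=.
    exact: unit_src.
  exact: unit_rng.
rewrite -rS; apply: se.
  by split=> //; exact: closed_subspaceT.
rewrite uS; apply/seteqP; split=> [_ [x _ <-]|x xu]; first exact: unit_rng.
exists x; last exact/unit_spaceP.
by split; [exact: cocycle_unit|rewrite /= src_unit].
Qed.

(** * Graded ideals and indicators of sets of units *)

Section GradedIdeal.
Context (J : set (G -> K^o)) (J_ideal : is_ideal conv A J).

Let J0 : J 0.
Proof. by case: J_ideal. Qed.

Let JA : J `<=` A.
Proof. by case: J_ideal. Qed.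

Let JL (k : K) f a : J f -> J a -> J (k *: f + a).
Proof. by case: J_ideal => _ _ + _; apply. Qed.

Let Jl a f : A a -> J f -> J (conv a f).
Proof. by move=> Aa Jf; case: J_ideal => _ _ _ /(_ a f Aa Jf) []. Qed.

Let Jr a f : A a -> J f -> J (conv f a).
Proof. by move=> Aa Jf; case: J_ideal => _ _ _ /(_ a f Aa Jf) []. Qed.

Let JZ (k : K) f : J f -> J (k *: f).
Proof. by move=> Jf; rewrite -[_ *: _]addr0; exact: JL. Qed.

(** Translating a nonzero value of a homogeneous element by an inverse bisection
  yields an element of degree [1] that does not vanish on the unit space. *)
Lemma degree1_element h f : Ah h f -> J f -> f <> 0 ->
  exists a u, [/\ J a, Ah 1%g a, unit_space u & a u <> 0].
Proof.
move=> Ahf Jf fn0; have [Af fh] := (componentP _ _).1 Ahf.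
have [g fg] : exists g, f g <> 0.
  apply: contrapT => no; apply: fn0; apply/funext => g.
  by apply: contrapT => fg; apply: no; exists g.
have cg : c g = h by apply: contrapT => cg; apply: fg; exact: fh.
have [||B [cB Bg Bh]] := cob_basis G_ample (g := g) (U := c @^-1` [set h]).
- exact: fiber_open.
- exact: cg.
have cB' := ginv_cob cB; have [_ _ bB'] := cB'.
have AB' : A \1_(@ginv G @^-1` B) by exact: steinberg_indic.
exists (conv \1_(@ginv G @^-1` B) f), (src g); split.
- exact: Jl.
- apply/componentP; split; first exact: convolution_closed.
  move=> x cx.
  have [[y [By yx]]|no] := pselect (exists y, B (ginv y) /\ rng y = rng x).
    rewrite (@convolution_indicl _ _ _ _ y)//; apply: fh => cyx; apply: cx.
    have ch : c (ginv y) = h := Bh _ By; apply: (@mulgI _ h).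
    by rewrite mulg1 -[in RHS]cyx c_cocycle ?src_ginv// ch.
  by apply: convolution_indicl0 => y By yx; apply: no; exists y.
- exact: unit_src.
- rewrite (@convolution_indicl _ _ _ _ (ginv g)) ?rng_ginv ?rng_src//.
    by rewrite ginvK gmul_src.
  by rewrite /= ginvK.
Qed.

(** The uniqueness argument: compressing an element of degree [1] by the
  indicator of a small set of units removes its part outside the unit space. *)
Lemma ideal_contains_indic h f : effective (c @^-1` [set 1%g]) ->
  Ah h f -> J f -> f <> 0 ->
  exists V, [/\ compact_open_bisection V, V !=set0, V `<=` unit_space & J \1_V].
Proof.
move=> effS Ahf Jf fn0.
have [a [u [Ja Aa1 uu au]]] := degree1_element Ahf Jf fn0.
have [Aa ah] := (componentP _ _).1 Aa1.
have nu : nbhs u [set y | a y = a u] by exact: steinberg_locally_constant.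
pose D := [set y | a y = a u]° `&` unit_space.
have oD : open D by apply: openI; [exact: open_interior|exact: unit_space_open].
have [|E [oE [e Ee] ED Ea]] :=
    shrink_support effS (@fiber_open 1%g) (@fiber_closed 1%g) Aa oD.
  by exists u; split.
have [V [cV Ve VE]] := cob_basis G_ample oE Ee.
have Vu : V `<=` unit_space by move=> x /VE /ED [].
exists V; split=> //; first by exists e.
have AV : A \1_V by exact: steinberg_indic.
suff -> : (\1_V : G -> K^o) = (a u : K)^-1 *: conv (conv \1_V a) \1_V.
  by apply: JZ; apply: Jr => //; exact: Jl.
apply/funext => x; rewrite fctE convolution_unitr// convolution_unitl//.
have [Vs|Vs] := pselect (V (src x)); last first.
  rewrite (indic_out _ Vs) mulr0 scaler0 indic_out// => Vx; apply: Vs.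
  by rewrite src_unit//; exact: Vu.
rewrite (indic_in _ Vs) mulr1.
have [Vr|Vr] := pselect (V (rng x)); last first.
  rewrite (indic_out _ Vr) mul0r scaler0 indic_out// => Vx; apply: Vr.
  by rewrite (unit_spaceP _).1//; exact: Vu.
rewrite (indic_in _ Vr) mul1r.
have [xu|xu] := pselect (unit_space x).
  rewrite src_unit// in Vs; rewrite indic_in//.
  have /interior_subset /= -> : [set y | a y = a u]° x by have [] := ED _ (VE _ Vs).
  by rewrite -[_ *: _]/(_ * _ : K) mulVf//; exact/eqP.
rewrite indic_out; last by move=> /Vu.
suff -> : a x = 0 by rewrite scaler0.
apply: contrapT => ax; apply: (Ea x) => //; try exact: VE.
by apply: contrapT => cx; apply: ax; exact: ah.
Qed.

Definition ideal_units : set G :=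
  [set u | exists V, [/\ compact_open_bisection V, V u, V `<=` unit_space & J \1_V]].

Lemma ideal_units_open : open ideal_units.
Proof.
rewrite openE => u [V [cV Vu Vs JV]]; have [_ oV _] := cV.
apply: (@filterS _ _ _ V); last exact: open_nbhs_nbhs.
by move=> v Vv; exists V.
Qed.

(** Conjugation by a bisection through [g] moves the indicators in [J] from
  [src g] to [rng g]. *)
Lemma ideal_units_rng g : ideal_units (src g) -> ideal_units (rng g).
Proof.
move=> [V [cV Vg Vs JV]].
have [B [cB Bg _]] := cob_basis G_ample (g := g) openT I.
have cB' := ginv_cob cB; have cVB' := gmul_set_cob G_ample cV cB'.
exists (gmul_set B (gmul_set V (@ginv G @^-1` B))); split.
- exact: gmul_set_cob.
- exists (g, ginv g) => /=; last by rewrite gmulV.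
  split=> //=; last by rewrite rng_ginv.
  exists (src g, ginv g) => /=; last by rewrite -rng_ginv gmul_rng.
  by split=> //=; rewrite ?ginvK// src_src rng_ginv.
- move=> _ [[x y] /= [Bx [[v z] /= [Vv Bz vz] <-] xv] <-].
  have vu := Vs _ Vv; have vE := (unit_spaceP _).1 vu.
  move: xv; rewrite rng_gmul// => xv; rewrite vE in xv; rewrite src_unit// in vz.
  rewrite vz gmul_rng.
  have [_ _ [_ sB]] := cB.
  have -> : x = ginv z.
    by apply: sB; rewrite ?inE// xv vz src_ginv.
  by rewrite gmulVg; exact: unit_src.
- have [_ _ bB] := cB; have [_ _ bV] := cV; have [_ _ bB'] := cB'.
  have [_ _ bVB'] := cVB'.
  rewrite -[\1_ _]convolution_indic// -[\1_(gmul_set V _)]convolution_indic//.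
  apply: Jl; first exact: steinberg_indic.
  by apply: Jr => //; exact: steinberg_indic.
Qed.

(** The sets of units whose indicator is in [J] are closed under finite unions,
  because [\1_V * \1_W] is the indicator of [V `&` W]. *)
Lemma ideal_units_compact C : compact C -> C `<=` ideal_units ->
  exists V, [/\ C `<=` V, V `<=` unit_space & J \1_V].
Proof.
move=> cC CU; have [||x /CU[V [[_ oV _] Vx VU JV]]|V [VU JV] CV] :=
    compact_directed_cover (P := fun V => V `<=` unit_space /\ J \1_V) cC.
- by split=> //; rewrite indic0; exact: J0.
- move=> V W [VU JV] [WU JW]; split; first by move=> x [/VU|/WU].
  have -> : (\1_(V `|` W) : G -> K^o) = (-1) *: conv \1_V \1_W + (1 *: \1_V + \1_W).
    apply/funext => x; rewrite !fctE convolution_unitr// scaleN1r scale1r.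
    have [Vx|Vx] := pselect (V x).
      rewrite (indic_in _ Vx) mul1r (src_unit (VU _ Vx)) addrCA addNr addr0 indic_in//.
      by left.
    rewrite (indic_out _ Vx) mul0r oppr0 !add0r.
    have [Wx|Wx] := pselect (W x); first by rewrite !indic_in//; right.
    by rewrite !indic_out// => -[].
  by apply: JL; [apply: Jr => //; exact: JA|exact: JL].
- by exists V; [split|exact: open_nbhs_nbhs].
- by exists V.
Qed.

(** The sources of the support form a compact set [C]. Some [\1_V] in [J] has
  [C `<=` V], and [f * \1_V = f]. *)
Lemma ideal_contains_supported f : A f ->
  (forall x, f x <> 0 -> ideal_units (src x)) -> J f.
Proof.
move=> Af fU.
have [|_ [x fx <-]|V [CV VU JV]] :=
    @ideal_units_compact (@src G @` [set x | f x <> 0]).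
- apply: continuous_compact; first exact/continuous_subspaceT/src_continuous.
  exact: steinberg_compact_support.
- exact: fU.
rewrite (_ : f = conv f \1_V); first exact: Jl.
apply/funext => x; rewrite convolution_unitr//.
have [fx|fx] := pselect (f x = 0); first by rewrite fx mul0r.
by rewrite indic_in ?mulr1//; apply: CV; exists x.
Qed.

End GradedIdeal.

(** The complement of [ideal_units J] in the unit space is closed, invariant and
  proper, and [J] contains all functions that vanish on the restriction to it. *)
Lemma finite_codimension J :
  strongly_effective (c @^-1` [set 1%g]) ->
  (forall W : set G, W `<` unit_space -> closed_in_units [set: G] W ->
    invariant_in [set: G] W -> finite_set (restriction [set: G] W)) ->
  is_graded_ideal conv A Ah J -> J <> [set 0] -> finite_dim_quotient A J.
Proof.
move=> se fin [idl [JE _]] Jn0.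
have [JA J0 _ _] := idl.
have [f [Jf fn0]] : exists f, J f /\ f <> 0.
  apply: contrapT => no; apply: Jn0; apply/seteqP; split=> [f Jf|_ ->//].
  by apply: contrapT => fn0; apply: no; exists f.
have [h [b [Ahb Jb bn0]]] : exists h b, [/\ Ah h b, J b & b <> 0].
  have [b [bJ _] fE] : exists2 b, finite_section (fun h => Ah h `&` J) b &
      f = \sum_(h \in [set: H]) b h by move: Jf; rewrite {1}JE.
  apply: contrapT => no; apply: fn0; rewrite fE; apply: fsbig1 => h _.
  by apply: contrapT => bn0; apply: no; exists h, (b h); have [] := bJ h.
have [V [cV [v Vv] Vu JV]] :=
  ideal_contains_indic idl (effective_kernel se) Ahb Jb bn0.
pose W := @unit_space G `&` ~` ideal_units J.
have Winv : invariant_in [set: G] W.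
  apply/seteqP; split=> [_ [x [_ [_ /= Wx]] <-]|x Wx].
    split; first exact: unit_rng.
    rewrite /= -src_ginv => /(ideal_units_rng idl); by rewrite rng_ginv.
  have [xu _] := Wx; exists x; last exact/unit_spaceP.
  by split=> //=; rewrite src_unit.
apply: (@finite_dim_quotient_of_finite _ G_ample K (restriction [set: G] W)).
  apply: fin => //.
  - split; first by move=> x [].
    by move=> /(_ v (Vu _ Vv)) [_]; apply; exists V.
  - rewrite /closed_in_units /units setTI; split; first by move=> x [].
    apply: closed_subspaceW; apply: closedI; first exact: unit_space_closed.
    exact/open_closedC/ideal_units_open.
move=> a Aa a0; apply: (ideal_contains_supported idl Aa) => x ax.
apply: contrapT => nU; apply: ax; apply: a0; split=> //.
have Ws : W (src x) by split=> //; exact: unit_src.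
by split=> //=; apply/(invariantP x Winv).
Qed.

End Grading.

(** * Graded just infinite Steinberg algebras *)

Theorem theorem4p11 (G : topGroupoid) (K : fieldType) (H : groupType)
    (c : G -> H) (G_infinite : infinite_set [set: G])
    (G_ample : ample_hausdorff G)
    (c_cocycle : cocycle c)
    (c_continuous : continuous (c : G -> discrete_topology H))
    (c_kernel : strongly_effective (c @^-1` [set 1%g])) :
  graded_just_infinite (convolution G K) (steinberg G K)
      (steinberg_component K c) <->
  (forall W : set G, W `<` unit_space -> closed_in_units [set: G] W ->
    invariant_in [set: G] W -> finite_set (restriction [set: G] W)).
Proof.
split=> [gji W|fin]; first exact: (finite_restriction G_ample c_continuous gji).
split; last by move=> J; exact: (finite_codimension G_ample c_cocycle c_continuous).
move=> [s sA As]; apply: G_infinite.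
apply: (@finite_of_finite_dim_quotient _ G_ample K _ [set 0]).
  by move=> _ ->.
by exists s => // f /As sf; exists f => //; exists 0 => //; rewrite addr0.
Qed.
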